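(* Let $2\le k\le n-1$ and let $G$ be a connected graph with $n$ vertices whose chromatic number is $k$ or whose clique number is $k$. Then $\sigma_0(G)\le f_0(n,n-k+1)$ and $\sigma_1(G)\le f_1(n,n-k+1)$, and both bounds hold with equality for $G=B_{n,n-k+1}$.
   Context: All graphs are finite, simple, undirected. For a connected graph $G$ and $u\in V(G)$, $\varepsilon_G(u)=\max_{v} d_G(u,v)$; $\sigma_0(G)=\frac1{|V(G)|}\sum_u\varepsilon_G(u)$, $\sigma_1(G)=\sum_u\varepsilon_G(u)^2$. For integers $n>d\ge2$: $f_0(n,d)=d-\frac1n\lfloor d^2/4\rfloor$ and $f_1(n,d)=nd^2-\frac{5d}{12}(d^2-1)-\epsilon_d$, where $\epsilon_d=d/4$ if $d$ is even and $\epsilon_d=0$ if $d$ is odd (these are the maximum values of $\sigma_0$, $\sigma_1$ over $n$-vertex trees of diameter $d$). $B_{n,d}$ is obtained from a path $v_0v_1\cdots v_d$ by adding $n-d-1$ new vertices that are pairwise adjacent and each adjacent to $v_0$ and $v_1$. *)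

(* Defs.v *)
From mathcomp Require Import all_boot all_order all_algebra.
Set Implicit Arguments. Unset Strict Implicit. Unset Printing Implicit Defensive.
Import Order.TTheory GRing.Theory Num.Theory.

Section Graphs.
Variables (T : finType) (e : rel T).

Definition simple_graph := symmetric e /\ irreflexive e.

Definition connected_graph := forall x y : T, connect e x y.

Definition walk_len (k : nat) (x y : T) : bool :=
  [exists p : k.-tuple T, path e x p && (last x p == y)].

(* graph distance: the least k such that a walk of length k joins x and y
   (for connected graphs this is < #|T|) *)
Definition gdist (x y : T) : nat :=
  find (fun k => walk_len k x y) (iota 0 #|T|).

Definition ecc (u : T) : nat := \max_(v : T) gdist u v.

Definition sigma0 : rat := (\sum_(u : T) ecc u)%:R / #|T|%:R.
Definition sigma1 : nat := \sum_(u : T) (ecc u) ^ 2.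

Definition proper_colouring (k : nat) (c : {ffun T -> 'I_k}) : bool :=
  [forall x, forall y, e x y ==> (c x != c y)].

Definition chromatic_number : nat :=
  find (fun k => [exists c : {ffun T -> 'I_k}, proper_colouring c])
       (iota 0 #|T|.+1).

Definition is_clique (S : {set T}) : bool :=
  [forall x in S, forall y in S, (x != y) ==> e x y].

Definition clique_number : nat := \max_(S : {set T} | is_clique S) #|S|.

End Graphs.

Local Open Scope ring_scope.

Definition f0 (n d : nat) : rat := d%:R - (((d * d) %/ 4)%N)%:R / n%:R.

Definition eps_d (d : nat) : rat := if odd d then 0 else d%:R / 4%:R.

Definition f1 (n d : nat) : rat :=
  (n * d ^ 2)%N%:R - 5%:R * d%:R / 12%:R * ((d ^ 2)%N%:R - 1) - eps_d d.

(* B_{n,d} on vertex set 'I_n: vertices 0..d form the path v_0 ... v_d,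
   vertices d+1..n-1 are the added vertices, pairwise adjacent and each
   adjacent to v_0 and v_1. *)
Definition B_rel (n d : nat) : rel 'I_n := fun i j =>
  (i != j) &&
  [|| ((i <= d)%N && (j <= d)%N && ((val i == (val j).+1) || (val j == (val i).+1))),
      ((d < i)%N && (d < j)%N),
      ((d < i)%N && (j <= 1)%N)
    | ((d < j)%N && (i <= 1)%N)].

(* Main.v *)
(** Call tree metric a pointwise upper bound of the graph distance, on a set A
    of vertices, that has geodesics and satisfies the four-point condition.
    Attaching a pendant vertex enlarges A by one and the diameter by at most
    one, so a tree metric with diameter at most |A| - k + 1 on a start set A
    extends to all vertices with diameter at most n - k + 1.  The vertices of a
    longest geodesic then have eccentricities at most those of a path, which
    bounds the sum of any increasing function of the eccentricities by its
    value on B_{n,n-k+1}.  A start set is a clique of order k, or the closed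
    neighbourhood of a vertex of degree at least k.  If the chromatic number is
    k >= 4 and all degrees are below k, the graph is (k-1)-regular, and the union
    of two adjacent closed neighbourhoods works unless k - 1 colours suffice.
    If k = 3 and all degrees are at most 2, the graph is an odd cycle, whose
    eccentricities are all at most (n - 1) / 2. *)
Require Import Defs.
From mathcomp Require Import all_boot all_order all_algebra.
From mathcomp Require Import zify ring lra.
Import Order.TTheory GRing.Theory Num.Theory.
Local Open Scope ring_scope.

(** * Graph distance and eccentricity *)

Section Distance.
Local Open Scope nat_scope.
Set Implicit Arguments. Unset Strict Implicit.
Variables (T : finType) (e : rel T).

Lemma gdist_le_size x p : path e x p -> gdist e x (last x p) <= size p.
Proof.
move=> xp; rewrite /gdist; case: (ltnP (size p) #|T|) => hp; last first.
  (* [find] returns at most the length [#|T|] of the searched list, so a walk this long satisfies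
     the bound trivially. *)
  by apply: leq_trans hp; rewrite -[leqRHS](size_iota 0) find_size.
have xp_walk : walk_len e (size p) x (last x p).
  by apply/existsP; exists (in_tuple p); rewrite /= xp eqxx.
rewrite leqNgt; apply/negP => /(before_find 0).
by rewrite nth_iota // add0n xp_walk.
Qed.

Lemma gdistxx x : gdist e x x = 0.
Proof. by apply/eqP; rewrite -leqn0; exact: (@gdist_le_size x [::]). Qed.

Lemma gdist1 x y : e x y -> gdist e x y <= 1.
Proof. by move=> xy; apply: (@gdist_le_size x [:: y]); rewrite /= xy. Qed.

Lemma gdist_le_ecc x y : gdist e x y <= ecc e x.
Proof. exact: (leq_bigmax (F := gdist e x)). Qed.

Lemma ecc_leP x m : reflect (forall y, gdist e x y <= m) (ecc e x <= m).
Proof.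
by apply: (iffP (bigmax_leqP _ _ _)) => h y; [exact: h | move=> _; exact: h].
Qed.

Hypotheses (e_sym : symmetric e) (e_con : connected_graph e).

Lemma gdist_path x y :
  exists p, [/\ path e x p, last x p = y & size p = gdist e x y].
Proof.
have [p0 xp0 ->] := connectP (e_con x y).
case/shortenP: xp0 => p xp up _.
set y' := last x p.
(* A duplicate-free path has fewer than [#|T|] edges, so the search in [iota 0 #|T|] succeeds. *)
have szp : size p < #|T| by have := max_card (mem (x :: p)); rewrite (card_uniqP up).
have hw : has (fun k => walk_len e k x y') (iota 0 #|T|).
  apply/hasP; exists (size p); first by rewrite mem_iota.
  by rewrite /walk_len; apply/existsP; exists (in_tuple p); rewrite /= xp eqxx.
have := nth_find 0 hw; rewrite -/(gdist e x y') nth_iota; last first.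
  by rewrite /gdist -[ltnRHS](size_iota 0) -has_find.
rewrite add0n => /existsP[q /andP[xq /eqP lq]].
by exists q; rewrite size_tuple.
Qed.

Lemma gdistC x y : gdist e x y = gdist e y x.
Proof.
suff le x' y' : gdist e x' y' <= gdist e y' x' by apply/eqP; rewrite eqn_leq !le.
have [p [yp lp <-]] := gdist_path y' x'.
have := @gdist_le_size (last y' p) (rev (belast y' p)).
rewrite rev_path size_rev size_belast => h.
have {}h : gdist e (last y' p) (last (last y' p) (rev (belast y' p))) <= size p.
  by apply: h; rewrite (@eq_path _ _ e) // => a b; rewrite e_sym.
suff <- : last (last y' p) (rev (belast y' p)) = y' by rewrite -{1}lp.
by case: (p) => //= a s; rewrite rev_cons last_rcons.
Qed.

Lemma gdist_edge x y z : e y z -> gdist e x z <= (gdist e x y).+1.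
Proof.
have [p [xp lp <-]] := gdist_path x y => yz.
have := @gdist_le_size x (rcons p z); rewrite last_rcons size_rcons; apply.
by rewrite rcons_path xp lp.
Qed.

Lemma gdist_parent x y : y != x ->
  exists2 z, e z y & gdist e x y = (gdist e x z).+1.
Proof.
have [p [xp lp sp]] := gdist_path x y => yx.
case/lastP: p => [|p t] in xp lp sp *; first by rewrite -lp eqxx in yx.
rewrite last_rcons in lp; subst t.
move: xp; rewrite rcons_path => /andP[xp zy]; exists (last x p) => //.
apply/eqP; rewrite eqn_leq gdist_edge //= -sp size_rcons ltnS.
exact: gdist_le_size.
Qed.

Lemma gdist_eq0 x y : gdist e x y = 0 -> y = x.
Proof. by apply: contra_eq => /gdist_parent[z _ ->]. Qed.

(** Source of lower bounds on distances: along a geodesic the potential rises by at most one per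
    edge. *)
Lemma gdist_lipschitz (phi : T -> nat) x y :
  (forall u w, e u w -> phi w <= (phi u).+1) -> phi y <= phi x + gdist e x y.
Proof.
move=> lip; have [p [xp lp <-]] := gdist_path x y.
elim: p x xp lp => /= [|z p IH] x; first by move=> _ <-; rewrite addn0.
by case/andP=> /lip xz zp lp; have := IH z zp lp; lia.
Qed.

Lemma boundary_edge (A : {set T}) x0 : x0 \in A -> A != setT ->
  exists y x, [/\ y \in A, x \notin A & e y x].
Proof.
move=> Ax0 /eqP AT.
case: (boolP [exists y, exists x, [&& y \in A, x \notin A & e y x]]).
  by case/existsP=> y /existsP[x /and3P[]]; exists y, x.
move=> nex; case: AT; apply/setP=> t; rewrite inE.
have clA : closed e (mem A).
  apply: (intro_closed (sym_connect_sym e_sym)) => a b ab aA.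
  apply: contraNT nex => bA.
  by apply/existsP; exists a; apply/existsP; exists b; rewrite aA bA.
by rewrite -(closed_connect clA (e_con x0 t)).
Qed.

End Distance.

(** * Tree metrics and their extension by pendant vertices *)

Section TreeMetric.
Local Open Scope nat_scope.
Set Implicit Arguments. Unset Strict Implicit.
Variables (T : finType) (e : rel T).
Hypotheses (e_sym : symmetric e) (e_con : connected_graph e).

(** The four-point condition characterises metrics that embed in trees. The algebraic axioms hold on
    all of [T], so that they can be instantiated without membership proofs; the bound on [gdist],
    the diameter and the geodesics concern [A] only. *)
Record tree_metric (A : {set T}) (delta : T -> T -> nat) (m : nat) : Prop :=
  TreeMetric {
  tm_refl : forall x, delta x x = 0;
  tm_sym : forall x y, delta x y = delta y x;
  tm_four_point : forall x y z t, delta x y + delta z t <=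
    maxn (delta x z + delta y t) (delta x t + delta y z);
  tm_gdist : {in A &, forall x y, gdist e x y <= delta x y};
  tm_diam : {in A &, forall x y, delta x y <= m};
  tm_geodesic : {in A &, forall x y i, i <= delta x y ->
    exists z, [/\ z \in A, delta x z = i & delta z y = delta x y - i]}
}.

Lemma tree_metric_weaken A delta m m' :
  m <= m' -> tree_metric A delta m -> tree_metric A delta m'.
Proof.
move=> mm' [? ? ? ? dm ?]; split=> // x y xA yA.
exact: leq_trans (dm x y xA yA) mm'.
Qed.

(** The equilateral metric is that of a star whose legs have length 1/2. Its diameter is 1, whereas
    a spanning tree of a clique with at least three vertices has diameter at least 2; hence tree
    metrics instead of spanning trees. *)
Lemma clique_tree_metric A : is_clique e A ->
  tree_metric A (fun x y => (x != y) : nat) 1.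
Proof.
move=> /forall_inP clA; split=> [x|x y|x y z t|x y xA yA|x y _ _|x y xA yA i].
- by rewrite eqxx.
- by rewrite eq_sym.
(* Transitivity of equality, contraposed; four instances reduce the four-point condition to a truth
   table. *)
- have um (a b c : T) : (a != c) ==> (a != b) || (b != c).
    by apply/implyP; apply: contraR; rewrite negb_or !negbK => /andP[/eqP->].
  move: (um z x t) (um z y t) (um x z y) (um x t y); rewrite (eq_sym z x).
  rewrite (eq_sym z y) (eq_sym t y).
  by do 6 case: (_ != _).
- have [<-|xy] := eqVneq x y; first by rewrite gdistxx.
  apply: gdist1; move/forall_inP: (clA x xA) => /(_ y yA) /implyP; exact.
- exact: leq_b1.
- case: i => [|i] hi; first by exists x; rewrite eqxx subn0.
  exists y; rewrite yA eqxx; split=> //; move: hi; case: (x != y) => //=; lia.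
Qed.

(** The metric after gluing a leaf [x] to [y]: each end equal to [x] moves to [y] at cost one,
    except that the pair [(x, x)] gets 0 and not 2. Earlier values of [delta] at [x] are
    discarded. *)
Definition hang (x y : T) (delta : T -> T -> nat) (u w : T) : nat :=
  if (u == x) && (w == x) then 0 else
  delta (if u == x then y else u) (if w == x then y else w)
    + ((u == x) + (w == x)).

Lemma hang_tree_metric A delta m x y : tree_metric A delta m ->
  y \in A -> x \notin A -> e y x -> 0 < m ->
  {in A, forall u, delta y u < m} ->
  tree_metric (x |: A) (hang x y delta) m.
Proof.
move=> tm yA xA yx m0 ym.
have nx u : u \in A -> (u == x) = false.
  by move=> uA; apply/eqP=> ux; rewrite -ux uA in xA.
have [rfl sy four dg dm geo] := tm.
split=> [u|u w|a b c d|u w|u w|u w].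
- by rewrite /hang rfl; case: eqP.
- by rewrite /hang sy andbC (addnC (u == x)).
- rewrite /hang.
  move: (four (if a == x then y else a) (if b == x then y else b)
              (if c == x then y else c) (if d == x then y else d)).
  move: (rfl y) (sy a y) (sy b y) (sy c y) (sy d y).
  (* With [y] doubled the condition becomes the triangle inequality through [y]; this serves the
     cases in which [x] is repeated. *)
  move: (four y y a b) (four y y a c) (four y y a d) (four y y b c)
        (four y y b d) (four y y c d).
  by case: (a == x); case: (b == x); case: (c == x); case: (d == x) => /=; lia.
- rewrite !inE => /orP[/eqP->|uA] /orP[/eqP->|wA]; rewrite /hang ?eqxx ?nx //=.
  + by rewrite gdistxx.
  + rewrite gdistC // addn1; apply: leq_trans (gdist_edge e_con w yx) _.
    by rewrite ltnS sy dg.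
  + rewrite add0n addn1; apply: leq_trans (gdist_edge e_con u yx) _.
    by rewrite ltnS dg.
  + by rewrite !addn0 dg.
- rewrite !inE => /orP[/eqP->|uA] /orP[/eqP->|wA]; rewrite /hang ?eqxx ?nx //=.
  + by rewrite addn1 ym.
  + by rewrite add0n addn1 sy ym.
  + by rewrite !addn0 dm.
- have xx : hang x y delta x x = 0 by rewrite /hang eqxx.
  have inA s t : s \in A -> t \in A -> hang x y delta s t = delta s t.
    by move=> sA tA; rewrite /hang !nx //= !addn0.
  have xt t : t \in A -> hang x y delta x t = (delta y t).+1.
    by move=> tA; rewrite /hang eqxx nx //= ?add0n addn1.
  have tx t : t \in A -> hang x y delta t x = (delta t y).+1.
    by move=> tA; rewrite /hang eqxx nx //= ?add0n addn1.
  rewrite !inE => /orP[/eqP->|uA] /orP[/eqP->|wA] i.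
  + by rewrite xx leqn0 => /eqP->; exists x; rewrite !inE eqxx xx.
  + rewrite xt //; case: i => [|i] hi.
      by exists x; rewrite !inE eqxx xx xt.
    have [z [zA dz dz']] := geo y w yA wA i hi.
    by exists z; rewrite !inE zA orbT xt // inA // dz dz'.
  + rewrite tx // leq_eqVlt => /orP[/eqP->|hi].
      by exists x; rewrite !inE eqxx xx tx // subnn.
    have [z [zA dz dz']] := geo u y uA yA i hi.
    exists z; rewrite !inE zA orbT tx // inA // dz dz'; split=> //; lia.
  + rewrite inA // => hi; have [z [zA dz dz']] := geo u w uA wA i hi.
    by exists z; rewrite !inE zA orbT !inA.
Qed.

(** All leaves hang at the same [y]: each gets distance 1 < [m] from [y], so the hypothesis on
    distances from [y] survives the induction and the diameter bound stays [m]. *)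
Lemma hang_set_tree_metric A delta m y (B : {set T}) : tree_metric A delta m ->
  y \in A -> 1 < m -> {in A, forall u, delta y u < m} ->
  {in B, forall b, e y b} -> exists delta', tree_metric (A :|: B) delta' m.
Proof.
move: {2}#|B :\: A| (leqnn #|B :\: A|) => N.
elim: N A delta => [|N IH] A delta hN tm yA m1 ym yB.
  exists delta; suff -> : A :|: B = A by [].
  by apply/setUidPl; rewrite -setD_eq0 -cards_eq0 -leqn0.
case: (set_0Vmem (B :\: A)) => [BA|[b]].
  by exists delta; suff -> : A :|: B = A by []; apply/setUidPl; rewrite -setD_eq0 BA.
rewrite inE => /andP[bA bB].
have -> : A :|: B = (b |: A) :|: B.
  by apply/setP=> t; rewrite !inE; case: eqP => // ->; rewrite bB orbT.
have yb : (y == b) = false by apply/eqP => yb; rewrite -yb yA in bA.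
apply: (IH _ (hang b y delta)); rewrite ?inE ?yA ?orbT //.
- have -> : B :\: (b |: A) = (B :\: A) :\ b.
    by apply/setP=> t; rewrite !inE negb_or andbA.
  by move: hN; rewrite (cardsD1 b (B :\: A)) !inE bA bB.
- by apply: hang_tree_metric => //; [exact: yB | exact: ltnW].
- move=> u; rewrite !inE /hang yb /= => /orP[/eqP->|uA].
    by rewrite eqxx (tm_refl tm).
  by case: (eqVneq u b) => [ub|_]; [rewrite -ub uA in bA | rewrite !addn0 ym].
Qed.

Lemma spanning_tree_metric A delta m x0 : tree_metric A delta m -> x0 \in A ->
  exists delta', tree_metric setT delta' (m + (#|T| - #|A|)).
Proof.
move: {2}(#|T| - #|A|) (erefl (#|T| - #|A|)) => N.
elim: N A delta m => [|N IH] A delta m hN tm x0A; have [AT|AT] := eqVneq A setT.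
- by exists delta; rewrite hN addn0 -AT.
- have: A \proper setT by rewrite properT.
  by move/proper_card; rewrite cardsT; lia.
- by move: hN; rewrite AT cardsT subnn.
- have [y [x [yA xA yx]]] := boundary_edge e_sym e_con x0A AT.
  have tm' : tree_metric (x |: A) (hang x y delta) m.+1.
    apply: hang_tree_metric => //.
      exact: tree_metric_weaken tm.
    by move=> u uA; rewrite ltnS (tm_diam tm).
  have cA : #|x |: A| = #|A|.+1 by rewrite cardsU1 xA.
  have [||delta' tm2] := IH _ _ _ _ tm'.
  + by rewrite cA; lia.
  + by rewrite inE x0A orbT.
  exists delta'; move: tm2; rewrite cA.
  suff -> : m.+1 + (#|T| - #|A|.+1) = m + (#|T| - #|A|) by []; lia.
Qed.

End TreeMetric.

(** * Sums over the eccentricity profile of a path *)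

Section PathProfile.
Local Open Scope nat_scope.
Set Implicit Arguments. Unset Strict Implicit.

(* The eccentricity in B_{n,d} of the vertex with index i. *)
Definition path_ecc (d i : nat) : nat := if i <= d then maxn i (d - i) else d.

Lemma path_ecc_mono d D i : d <= D -> path_ecc d i <= path_ecc D i.
Proof. by rewrite /path_ecc => dD; case: (leqP i d) => ?; case: (leqP i D) => ?; lia. Qed.

Lemma sum_path_ecc_split (f : nat -> nat) n d : d < n ->
  \sum_(i < n) f (path_ecc d i) =
  \sum_(i < d.+1) f (maxn i (d - i)) + (n - d.+1) * f d.
Proof.
move=> dn; rewrite -(big_mkord xpredT (fun i => f (path_ecc d i))).
rewrite (big_cat_nat (n := d.+1)) //= big_mkord; congr (_ + _).
  by apply: eq_bigr => i _; rewrite /path_ecc -ltnS ltn_ord.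
rewrite -sum_nat_const_nat; apply: eq_big_nat => i /andP[di _].
by rewrite /path_ecc leqNgt di.
Qed.

(** Recursion from [d] to [d + 2]: adding a vertex at both ends of a path raises every old
    eccentricity by one. *)
Lemma sum_maxn_step (f : nat -> nat) d :
  \sum_(i < d.+3) f (maxn i (d.+2 - i)) =
  2 * f d.+2 + \sum_(i < d.+1) f (maxn i (d - i)).+1.
Proof.
rewrite big_ord_recl big_ord_recr /= subn0 max0n subnn maxn0.
rewrite (eq_bigr (fun i : 'I_d.+1 => f (maxn i (d - i)).+1)) => [|i _].
  by rewrite /bump /= add1n; lia.
congr f; have := ltn_ord i; rewrite /bump /=; lia.
Qed.

Lemma sum_maxn d : \sum_(i < d.+1) maxn i (d - i) + (d * d) %/ 4 = d.+1 * d.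
Proof.
elim/ltn_ind: d => -[|[|d]] IH; [by rewrite !big_ord_recl big_ord0 ..|].
rewrite (sum_maxn_step id).
have -> : d.+2 * d.+2 = d.+1 * 4 + d * d by lia.
rewrite divnMDl //.
under eq_bigr do rewrite -addn1.
rewrite big_split /= sum_nat_const card_ord.
have := IH d (leqnSn _).
by move: (\sum_(i < _) _) (_ %/ 4) => s q; lia.
Qed.

(** Twelve times the formula [f1] at [n = d + 1], with negative terms moved across; the parity term
    is [12 * eps_d]. The truncated [d ^ 2 - 1] is harmless at [d = 0], where its factor [d]
    vanishes. *)
Lemma sum_maxn_sqr d :
  12 * (\sum_(i < d.+1) maxn i (d - i) ^ 2) + 5 * d * (d ^ 2 - 1)
    + (~~ odd d) * (3 * d) = 12 * (d.+1 * d ^ 2).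
Proof.
elim/ltn_ind: d => -[|[|d]] IH; [by rewrite !big_ord_recl big_ord0 ..|].
rewrite (sum_maxn_step (fun x => x ^ 2)).
have -> : \sum_(i < d.+1) (maxn i (d - i)).+1 ^ 2 =
    \sum_(i < d.+1) maxn i (d - i) ^ 2 + 2 * (\sum_(i < d.+1) maxn i (d - i))
    + d.+1.
  rewrite big_distrr -[X in _ + X](card_ord d.+1) -sum1_card -!big_split /=.
  by apply: eq_bigr => i _; lia.
have := sum_maxn d; have {IH} := IH d (leqnSn _).
move: (\sum_(i < d.+1) _) => s2; move: (\sum_(i < d.+1) _) => s1.
(* Writing [d] as [2m] or [2m + 1] turns [(d * d) %/ 4] into the polynomial [m^2] or [m^2 + m]. *)
have [m []dE] : exists m, d = 2 * m \/ d = (2 * m).+1.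
- by exists d./2; have := odd_double_half d; case: (odd d); lia.
- have -> : (d * d) %/ 4 = m * m.
    by rewrite dE mulnACA mulKn.
  by rewrite dE /= mul2n odd_double /=; nia.
- have -> : (d * d) %/ 4 = m * m + m.
    have -> : d * d = (m * m + m) * 4 + 1 by rewrite dE; lia.
    by rewrite divnMDl // addn0.
  by rewrite dE /= mul2n odd_double /=; nia.
Qed.

End PathProfile.

(** * Closed forms [f0] and [f1] of the profile sums *)

Section PathProfileBounds.

Lemma sum_path_ecc_f0 n d : (d < n)%N ->
  (\sum_(i < n) path_ecc d i)%N%:R / n%:R = f0 n d.
Proof.
move=> dn; have n0 : n%:R != 0 :> rat by rewrite pnatr_eq0; lia.
suff eqn : ((\sum_(i < n) path_ecc d i) + (d * d) %/ 4 = n * d)%N.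
  have -> : (\sum_(i < n) path_ecc d i)%N%:R = n%:R * d%:R - ((d * d) %/ 4)%N%:R :> rat.
    by rewrite -natrM -eqn natrD addrK.
  by rewrite /f0; field.
have := sum_maxn d; rewrite (sum_path_ecc_split id) //=.
by move: (\sum_(i < _) _)%N (_ %/ 4)%N => s q; nia.
Qed.

Lemma sum_path_ecc_f1 n d : (0 < d < n)%N ->
  (\sum_(i < n) path_ecc d i ^ 2)%N%:R = f1 n d.
Proof.
case/andP=> d0 dn; rewrite (sum_path_ecc_split (fun x => x ^ 2)%N) //.
have := sum_maxn_sqr d; move: (\sum_(i < _) _)%N => s eqn.
have -> : n = (d.+1 + (n - d.+1))%N by lia.
move: (n - d.+1)%N => m; rewrite addKn.
have := congr1 (fun m => m%:R : rat) eqn.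
rewrite /= 2!natrD !natrM natrB ?expn_gt0 ?d0 // !natrX -(natr1 d) => h.
have sE : s%:R = ((d%:R + 1) * d%:R ^+ 2 - 5 / 12 * d%:R * (d%:R ^+ 2 - 1)
    - (~~ odd d)%:R * d%:R / 4) :> rat by lra.
rewrite /f1 /eps_d natrD sE !natrM natrD -(natr1 d).
by case: (odd d) => /=; field.
Qed.

End PathProfileBounds.

(** * Eccentricity sums under a spanning tree metric *)

Section Enumeration.
Local Open Scope nat_scope.
Set Implicit Arguments. Unset Strict Implicit.
Variables (T : finType) (e : rel T).

(* Along a longest geodesic z_0 ... z_d of the tree metric, the four-point condition gives ecc z_i <= max(i, d - i). *)
Lemma tree_metric_sum_ecc delta m (f : nat -> nat) : tree_metric e setT delta m ->
  0 < #|T| -> {homo f : i j / i <= j} ->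
  \sum_(u : T) f (ecc e u) <= \sum_(i < #|T|) f (path_ecc m i).
Proof.
move=> tm /card_gt0P[x0 _] fmono.
have [[p q] _ pq] := arg_maxnP (fun xy : T * T => delta xy.1 xy.2) (erefl : xpredT (x0, x0)).
set d := delta p q.
have {}pq x y : delta x y <= d by exact: (pq (x, y)).
have geo (i : 'I_d.+1) : exists z, delta p z = i /\ delta z q = d - i.
  have hi : i <= delta p q by rewrite -ltnS.
  have [z [_ ? ?]] := tm_geodesic tm (in_setT p) (in_setT q) hi.
  by exists z.
have [z zP] := fin_all_exists geo.
have zinj : injective z.
  by move=> i j ij; apply: val_inj; rewrite /= -(zP i).1 -(zP j).1 ij.
have dT : d < #|T| by have := leq_card z zinj; rewrite card_ord.
have ecc_le x : ecc e x <= d.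
  by apply/ecc_leP => y; apply: leq_trans (pq x y); apply: (tm_gdist tm); rewrite inE.
have ecc_z i : ecc e (z i) <= maxn i (d - i).
  apply/ecc_leP => y.
  have h : gdist e (z i) y <= delta (z i) y by apply: (tm_gdist tm); rewrite inE.
  (* Both sums on the right are at most [maxn i (d - i) + d], and [delta p q = d] cancels. *)
  have := tm_four_point tm (z i) y p q; rewrite (tm_sym tm _ p).
  by rewrite !(zP i).1 !(zP i).2 -/d; have := pq y q; have := pq y p; lia.
have dm : d <= m by apply: (tm_diam tm); rewrite inE.
apply: (@leq_trans (\sum_(i < #|T|) f (path_ecc d i))); last first.
  by apply: leq_sum => i _; apply: fmono; apply: path_ecc_mono.
(* The [d + 1] geodesic vertices are matched with the indices up to [d]; each remaining vertex has
   eccentricity at most [d]. *)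
rewrite sum_path_ecc_split // (bigID (mem (z @: setT))) /= leq_add //.
  rewrite big_imset /=; last by move=> i j _ _; apply: zinj.
  rewrite (eq_bigl xpredT) => [|i]; last by rewrite inE.
  by apply: leq_sum => i _; apply: fmono; exact: ecc_z.
apply: (@leq_trans (\sum_(u in ~: (z @: setT)) f d)).
  rewrite (eq_bigl (mem (~: (z @: setT)))) => [|u]; last by rewrite /= in_setC.
  by apply: leq_sum => u _; apply: fmono; exact: ecc_le.
by rewrite sum_nat_const cardsCs setCK card_imset // cardsT card_ord.
Qed.

End Enumeration.

(** * Eccentricities in B_{n,d} *)

Section ExtremalGraph.
Local Open Scope nat_scope.
Set Implicit Arguments. Unset Strict Implicit.
Variables (n d : nat).
Hypotheses (d2 : 2 <= d) (dn : d < n).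
Let B := @B_rel n d.
Let v i (h : i <= d) : 'I_n := Ordinal (leq_ltn_trans h dn).

Lemma B_rel_sym : symmetric B.
Proof.
move=> i j; rewrite /B /B_rel eq_sym; congr andb.
by rewrite (andbC (i <= d)) (andbC (d < i)) (orbC (val i == _)) (orbC (_ && (j <= 1))).
Qed.

Lemma B_rel_path (i j : 'I_n) : val j = i.+1 -> j <= d -> B i j.
Proof.
move=> ij jd; rewrite /B /B_rel -val_eqE /= ij eqxx orbT andbT.
have {}jd : i < d by rewrite -ij.
by rewrite ltn_eqF //= jd (ltnW jd).
Qed.

Lemma B_rel_added (i j : 'I_n) : d < i -> j <= 1 -> B i j.
Proof.
by move=> di j1; rewrite /B /B_rel -val_eqE /= di j1 !orbT andbT; lia.
Qed.

Lemma B_rel_con : connected_graph B.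
Proof.
pose v0 := v (leq0n d).
suff con i : connect B v0 i.
  by move=> i j; apply: connect_trans (con j); rewrite (sym_connect_sym B_rel_sym).
have path_con k (h : k <= d) : connect B v0 (v h).
  elim: k h => [|k IH] h; first by rewrite (_ : v h = v0) //; apply: val_inj.
  apply: connect_trans (IH (ltnW h)) (connect1 _); exact: B_rel_path.
case: (leqP i d) => [h|di].
  by rewrite (_ : i = v h) //; apply: val_inj.
by apply: connect1; rewrite B_rel_sym B_rel_added.
Qed.

Let gdistBC := gdistC B_rel_sym B_rel_con.

Lemma gdist_B_path (u i j : 'I_n) : i <= j -> j <= d ->
  gdist B u j <= gdist B u i + (j - i).
Proof.
case: j => j jn /=; elim: j jn => [|j IH] jn ij jd.
  by rewrite (_ : Ordinal jn = i) ?leq_addr //; apply: val_inj => /=; lia.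
case: (ltngtP i j.+1) ij => // [ij|ij] _; last first.
  by rewrite (_ : Ordinal jn = i) ?leq_addr //; apply: val_inj.
have := IH (ltnW jn) ij (ltnW jd).
have : B (Ordinal (ltnW jn)) (Ordinal jn) by apply: B_rel_path.
by move/(gdist_edge B_rel_con u) => /=; lia.
Qed.

(** The potential is the index along the path, with added vertices placed at [v_0]. It changes by at
    most one along an edge, since the path neighbours of an added vertex are [v_0] and [v_1]. *)
Lemma gdist_B_ge (i j : 'I_n) :
  (if j <= d then val j else 0) <= (if i <= d then val i else 0) + gdist B i j.
Proof.
apply: (gdist_lipschitz B_rel_con (phi := fun i => if i <= d then val i else 0)).
move=> a b; rewrite /B /B_rel -val_eqE /= => /andP[_].
case: (leqP a d) => ad; case: (leqP b d) => bd //=; lia.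
Qed.

Lemma ecc_B (i : 'I_n) : ecc B i = path_ecc d i.
Proof.
pose v0 := v (leq0n d); pose v1 := v (ltnW d2); pose vd := v (leqnn d).
(* An added vertex reaches [v_j] with [j > 0] through [v_1], in [1 + (j - 1)] steps; [v_0] is a
   neighbour, whence [maxn j 1]. *)
have added (a j : 'I_n) : d < a -> j <= d -> gdist B a j <= maxn j 1.
  move=> da jd; case: (posnP j) => j0.
    by apply: leq_trans (leq_maxr _ _); apply: gdist1; apply: B_rel_added; rewrite ?j0.
  have := gdist_B_path a (i := v1) (j := j) j0 jd.
  have := gdist1 (B_rel_added (i := a) (j := v1) da (leqnn 1)); rewrite /=; lia.
(* The lower bound is witnessed by the two ends [v0] and [vd] of the path. *)
apply/eqP; rewrite eqn_leq; apply/andP; split; last first.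
  have := gdist_B_ge i vd; have := gdist_B_ge v0 i.
  rewrite gdistBC /= leqnn.
  have := gdist_le_ecc B i vd; have := gdist_le_ecc B i v0.
  by rewrite /path_ecc; case: (leqP i d) => /=; lia.
apply/ecc_leP => j; rewrite /path_ecc.
case: (leqP i d) => id; case: (leqP j d) => jd.
- case: (leqP i j) => ij.
    by have := gdist_B_path i ij jd; rewrite gdistxx; lia.
  by have := gdist_B_path j (ltnW ij) id; rewrite gdistxx gdistBC; lia.
- by rewrite gdistBC; apply: leq_trans (added _ _ jd id) _; lia.
- by apply: leq_trans (added _ _ id jd) _; lia.
- have [->|ij] := eqVneq i j; first by rewrite gdistxx.
  have := @gdist1 _ B i j; rewrite {1}/B /B_rel ij id jd !orbT; lia.
Qed.

End ExtremalGraph.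

(** * Greedy colouring *)

Section Colouring.
Local Open Scope nat_scope.
Set Implicit Arguments. Unset Strict Implicit.
Variables (T : finType) (e : rel T).

Definition colourable q := exists c : T -> 'I_q, forall x y, e x y -> c x != c y.

Lemma chromatic_number_le q :
  q <= #|T| -> colourable q -> chromatic_number e <= q.
Proof.
move=> qT [c cP]; rewrite leqNgt; apply/negP => /(before_find 0).
rewrite nth_iota ?ltnS // add0n => /negbT/negP; apply.
apply/existsP; exists (finfun c); apply/forallP => x; apply/forallP => y.
by apply/implyP => xy; rewrite !ffunE cP.
Qed.

Lemma colourable_image (U : finType) (f : T -> U) q :
  (forall x y, e x y -> f x != f y) -> #|f @: setT| <= q -> colourable q.
Proof.
move=> fP fq; have idx x : index (f x) (enum (f @: setT)) < q.
  by apply: leq_trans fq; rewrite cardE index_mem mem_enum imset_f ?inE.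
exists (fun x => Ordinal (idx x)) => x y /fP; apply: contra.
rewrite -val_eqE /= => /eqP eqi; apply/eqP.
have memf z : f z \in enum (f @: setT) by rewrite mem_enum imset_f ?inE.
by rewrite -(nth_index (f x) (memf x)) eqi nth_index.
Qed.

Hypotheses (e_sym : symmetric e) (e_irr : irreflexive e).

(** Greedy colouring: remove a vertex with fewer than [q] neighbours in the current set, colour the
    rest, and give it a free colour. *)
Lemma degenerate_colourable q :
  (forall B : {set T}, B != set0 ->
    exists2 x, x \in B & #|[set y in B | e x y]| < q) ->
  colourable q.
Proof.
move=> dgn.
have col (A : {set T}) : exists c : T -> nat,
    {in A, forall x, c x < q} /\ {in A &, forall x y, e x y -> c x != c y}.
  move: {2}#|A| (erefl #|A|) => N; elim: N A => [|N IH] A hA.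
    move/eqP: hA; rewrite cards_eq0 => /eqP->; exists (fun=> 0).
    by split=> [x|x y]; rewrite inE.
  have A0 : A != set0 by rewrite -cards_eq0 hA.
  have [x xA degx] := dgn A A0.
  have [|c [cq cP]] := IH (A :\ x).
    by move: hA; rewrite (cardsD1 x) xA => -[].
  pose used := [set i : 'I_q | [exists y in A, e x y && (c y == i)]].
  have usedlt : #|used| < q.
    apply: (leq_ltn_trans _ degx).
    (* Only colours equal to some [i : 'I_q] are counted, so the default value of [insubd] is never
       the one that matters. *)
    pose h y := insubd (Ordinal (leq_ltn_trans (leq0n _) degx)) (c y) : 'I_q.
    apply: leq_trans (leq_imset_card h _); apply: subset_leq_card.
    apply/subsetP => i; rewrite inE => /existsP[y /and3P[yA xy /eqP cy]].
    apply/imsetP; exists y; first by rewrite inE yA.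
    by apply: val_inj; rewrite /h val_insubd cy ltn_ord.
  have [i] : exists i, i \in ~: used.
    by apply/card_gt0P; rewrite cardsCs setCK card_ord subn_gt0.
  rewrite !inE => /existsPn iP.
  have new y : y \in A -> e x y -> c y != i :> nat.
    by move=> yA xy; move: (iP y); rewrite yA xy.
  exists (fun y => if y == x then i : nat else c y); split=> [y|y z] yA.
    by case: eqVneq => // yx; rewrite cq // !inE yx.
  move=> zA yz; case: (eqVneq y x) (eqVneq z x) => [yx|yx] [zx|zx].
  - by rewrite yx zx e_irr in yz.
  - by rewrite eq_sym new // -yx.
  - by rewrite new // e_sym -zx.
  - by rewrite cP // !inE ?yx ?zx.
have [c [cq cP]] := col setT.
have {}cq x : c x < q by rewrite cq ?inE.
by exists (fun x => Ordinal (cq x)) => x y xy; rewrite -val_eqE /= cP ?inE.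
Qed.

Hypothesis e_con : connected_graph e.

(** In a nonempty set take the vertex closest to [v]. It is [v] itself, of small degree, or its
    parent towards [v] lies outside the set and lowers its degree there. *)
Lemma small_degree_colourable q v :
  #|[set y | e v y]| < q -> (forall x, #|[set y | e x y]| <= q) -> colourable q.
Proof.
move=> degv deg; apply: degenerate_colourable => B /set0Pn[b bB].
have [x xB xmin] := arg_minnP (gdist e v) bB.
exists x => //; have [->|xv] := eqVneq x v.
  apply: leq_ltn_trans degv; apply: subset_leq_card.
  by apply/subsetP => y; rewrite !inE => /andP[].
have [z zx dz] := gdist_parent e_con xv.
have zB : z \notin B by apply/negP => /xmin; rewrite dz ltnn.
apply: leq_trans (deg x); apply: proper_card; apply/properP; split.
  by apply/subsetP => y; rewrite !inE => /andP[].
by exists z; rewrite !inE ?(negPf zB) // e_sym.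
Qed.

End Colouring.

(** * Closed neighbourhoods as start sets, and the regular case *)

Section Cases.
Local Open Scope nat_scope.
Set Implicit Arguments. Unset Strict Implicit.
Variables (T : finType) (e : rel T).
Hypotheses (e_sym : symmetric e) (e_irr : irreflexive e).
Hypothesis e_con : connected_graph e.

Let nbr x := [set y | e x y].
Let cnbr x := x |: nbr x.

Lemma card_cnbr x : #|cnbr x| = #|nbr x|.+1.
Proof. by rewrite cardsU1 inE e_irr. Qed.

Lemma star_tree_metric v : exists delta, tree_metric e (cnbr v) delta 2.
Proof.
have clv : is_clique e [set v].
  apply/forall_inP => x; rewrite inE => /eqP->; apply/forall_inP => y.
  by rewrite inE => /eqP->; rewrite eqxx.
have tm := tree_metric_weaken (leqnSn 1) (clique_tree_metric clv).
apply: (hang_set_tree_metric e_sym e_con tm) => //; first by rewrite inE.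
  by move=> u; rewrite inE => /eqP->; rewrite eqxx.
by move=> b; rewrite inE.
Qed.

Lemma double_star_tree_metric v x : e v x ->
  exists delta, tree_metric e (cnbr v :|: cnbr x) delta 3.
Proof.
move=> vx; have [delta tm] := star_tree_metric v.
have xv : x \in cnbr v by rewrite !inE vx orbT.
have -> : cnbr v :|: cnbr x = cnbr v :|: nbr x.
  by apply/setP => y; rewrite !inE; case: (eqVneq y x) => [->|] //=; rewrite vx !orbT.
apply: (hang_set_tree_metric e_sym e_con (tree_metric_weaken (leqnSn 2) tm) xv) => //.
  by move=> u uv; rewrite ltnS; exact: (tm_diam tm).
by move=> b; rewrite inE.
Qed.

(* Adjacent closed neighbourhoods differ by at most a swap of one vertex; then any vertex at distance 2 from v is adjacent to all neighbours of v, so there are only k + 1 vertices, and two disjoint non-edges save two colours. *)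
Lemma swap_regular_colourable k : 4 <= k -> k < #|T| ->
  (forall x, #|nbr x| = k.-1) ->
  (forall v x, e v x -> #|cnbr v :|: cnbr x| <= k.+1) ->
  colourable e k.-1.
Proof.
move=> k4 kT reg dbl.
have card_cn x : #|cnbr x| = k by rewrite card_cnbr reg; lia.
have cnC x y : (x \in cnbr y) = (y \in cnbr x) by rewrite !inE e_sym eq_sym.
have cnxx x : x \in cnbr x by rewrite !inE eqxx.
have edge x y : y \in cnbr x -> y != x -> e x y by rewrite !inE => /orP[->|].
have cnD a b : #|cnbr b :\: cnbr a| = #|cnbr a :|: cnbr b| - k.
  have := subset_leq_card (subsetIl (cnbr a) (cnbr b)).
  by rewrite cardsD cardsU !card_cn setIC; lia.
have swap a b s t : e a b -> s \in cnbr b -> s \notin cnbr a ->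
    t \in cnbr b -> t \notin cnbr a -> s = t.
  move=> ab sb sa tb ta; have : #|cnbr b :\: cnbr a| <= 1.
    by rewrite cnD; have := dbl _ _ ab; lia.
  by move/card_le1_eqP; apply; rewrite inE ?sb ?tb ?sa ?ta.
have exch a b s : s \in cnbr a -> s \notin cnbr b ->
    exists2 t, t \in cnbr b & t \notin cnbr a.
  move=> sa sb; have : 0 < #|cnbr b :\: cnbr a|.
    by rewrite cnD setUC -cnD; apply/card_gt0P; exists s; rewrite inE sa sb.
  by case/card_gt0P=> t; rewrite inE => /andP[]; exists t.
have /card_gt0P[v _] : 0 < #|T| by lia.
have cvT : cnbr v != setT by apply/eqP => h; have := card_cn v; rewrite h cardsT; lia.
have [x [y [xv yv xy]]] := boundary_edge e_sym e_con (cnxx v) cvT.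
have vx : e v x by apply: edge => //; apply: contraNneq yv => <-; rewrite !inE xy orbT.
have yx : y \in cnbr x by rewrite !inE xy orbT.
have vy : v \notin cnbr y by rewrite cnC.
have yx_e : e y x by rewrite e_sym.
have xv_e : e x v by rewrite e_sym.
have vcx : v \in cnbr x by rewrite cnC.
have xcy : x \in cnbr y by rewrite cnC.
have xy_v s (sx : s \in cnbr x) (sy : s \notin cnbr y) : s = v.
  exact: (swap y x s v yx_e sx sy vcx vy).
have [w wv wx] := exch x v y yx yv.
have vx_w s (sv : s \in cnbr v) (sx : s \notin cnbr x) : s = w.
  exact: (swap x v s w xv_e sv sx wv wx).
have wnv : w != v by apply: contraNneq wx => ->.
have wnx : w != x by apply: contraNneq wx => ->.
have vy_w s : s \in cnbr v -> s != w -> s != v -> s \in cnbr y.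
  move=> sv sw; apply: contraNT => sy; apply/eqP/(xy_v s _ sy).
  by apply: contraNT sw => sx; rewrite (vx_w s sv sx).
(* Otherwise some [z] in [cnbr y] lies outside [cnbr x] and [cnbr v]. As [k >= 4], [cnbr v] has a
   vertex [x'] besides [v], [w], [x]; it is adjacent to both [y] and [z], so [cnbr x'] has two
   vertices outside [cnbr v]. *)
have wy : w \in cnbr y.
  apply/negPn/negP => wy.
  have [z zy zx] := exch x y v vcx vy.
  have zv : z \notin cnbr v.
    by apply/negP => zv; rewrite -(vx_w z zv zx) zy in wy.
  have zny : z != y by apply: contraNneq zx => ->.
  have [x' x'P] : exists x', x' \in cnbr v :\: [set v; w; x].
    apply/set0Pn; rewrite -cards_eq0 -lt0n.
    have := cardsID [set v; w; x] (cnbr v); rewrite card_cn.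
    have := subset_leq_card (subsetIr (cnbr v) [set v; w; x]).
    have : #|[set v; w; x]| <= 3.
      by rewrite setUC cardsU1 cards2; case: (_ \notin _); case: (_ != _).
    clear -k4; lia.
  move: x'P; rewrite in_setD => /andP[+ x'cv]; rewrite !in_setU !in_set1 !negb_or -andbA => /and3P[x'v x'w x'x].
  have x'y := vy_w x' x'cv x'w x'v.
  have x'z : z \in cnbr x'.
    rewrite cnC; apply: contraNT x'x => x'z; apply/eqP.
    have zy_e : e z y by rewrite e_sym edge.
    by apply: (swap z y x' x zy_e x'y x'z xcy); rewrite cnC.
  have vx' : e v x' by apply: edge.
  have yx' : y \in cnbr x' by rewrite cnC.
  by move/eqP: zny; apply; exact: (swap v x' z y vx' x'z zv yx' yv).
have vy_all s : s \in cnbr v -> s != v -> s \in cnbr y.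
  by move=> sv snv; case: (eqVneq s w) => [->|sw] //; apply: vy_w.
have cny : cnbr y = y |: (cnbr v :\ v).
  apply/esym/eqP; rewrite eqEcard; apply/andP; split.
    by apply/subsetP => s; rewrite in_setU1 in_setD1 => /orP[/eqP->//|/andP[? ?]]; apply: vy_all.
  rewrite card_cn cardsU1 inE (negPf yv) andbF /=.
  by rewrite -(card_cn v) (cardsD1 v) cnxx.
have all_in : y |: cnbr v = setT.
  apply/eqP/negPn/negP => AT.
  have yA : y \in y |: cnbr v by rewrite inE inE eqxx.
  have [a [b [aA bA ab]]] := boundary_edge e_sym e_con yA AT.
  move: bA; rewrite in_setU1 negb_or => /andP[bny bv].
  have ba : b \in cnbr a by rewrite !inE ab orbT.
  move: aA; rewrite in_setU1 => /orP[/eqP ay|av].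
    by move: ba; rewrite ay cny in_setU1 in_setD1 (negPf bny) (negPf bv) andbF.
  case: (eqVneq a v) => [av'|anv]; first by rewrite -av' ba in bv.
  have ya : y \in cnbr a by rewrite cnC vy_all.
  have va : e v a by apply: edge.
  by move/eqP: bny; apply; exact: (swap v a b y va ba bv ya yv).
have cT : #|T| = k.+1 by rewrite -cardsT -all_in cardsU1 yv card_cn.
(* The non-edges are [v y] and [x w]; merging each leaves an image that misses [y] and [w]. *)
pose f t := if t == y then v else if t == w then x else t.
have nvy : ~~ e v y by apply: contraNN yv => vy'; rewrite !inE vy' orbT.
have nxw : ~~ e x w by apply: contraNN wx => xw'; rewrite !inE xw' orbT.
have yw : w != y by apply: contraNneq yv => <-.
have yx' : x != y by apply: contraNneq yv => <-.
have yv' : v != y by apply: contraNneq yv => <-.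
apply: (colourable_image (f := f)).
  have st_neq s t : e s t -> s != t by apply: contraTneq => ->; rewrite e_irr.
  have vx_neq : v != x by exact: st_neq.
  move=> s t st; rewrite /f; case: (eqVneq s y) => [sy|sy].
    rewrite sy in st; case: (eqVneq t y) => [ty|ty].
      by rewrite ty e_irr in st.
    case: (eqVneq t w) => // tw.
    by apply: contraNneq nvy => ->; rewrite e_sym.
  case: (eqVneq t y) => [ty|ty].
    rewrite ty in st; case: (eqVneq s w) => [_|sw]; first by rewrite eq_sym.
    by apply: contraNneq nvy => <-.
  case: (eqVneq s w) => [sw|sw]; case: (eqVneq t w) => [tw|tw].
  - by rewrite sw tw e_irr in st.
  - by apply: contraNneq nxw => ->; rewrite e_sym -sw.
  - by apply: contraNneq nxw => <-; rewrite -tw.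
  - exact: st_neq.
have : f @: setT \subset ~: [set y; w].
  apply/subsetP => _ /imsetP[t _ ->]; rewrite !inE /f.
  case: (eqVneq t y) => [_|ty]; first by rewrite negb_or yv' eq_sym wnv.
  case: (eqVneq t w) => [_|tw]; first by rewrite negb_or yx' eq_sym wnx.
  by rewrite negb_or ty tw.
move/subset_leq_card/leq_trans; apply; have := cardsC [set y; w].
by rewrite cards2 eq_sym yw cT; clear; lia.
Qed.

End Cases.

(** * Non-bipartite graphs of maximum degree 2 *)

Section OddCycle.
Local Open Scope nat_scope.
Set Implicit Arguments. Unset Strict Implicit.
Variables (T : finType) (e : rel T).
Hypotheses (e_sym : symmetric e) (e_irr : irreflexive e).
Hypothesis e_con : connected_graph e.
Hypothesis deg2 : forall x, #|[set y | e x y]| <= 2.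

Lemma two_neighbours x p q r : e x p -> e x q -> p != q -> e x r ->
  r = p \/ r = q.
Proof.
move=> xp xq pq xr; have [->|rp] := eqVneq r p; first by left.
have [->|rq] := eqVneq r q; first by right.
have : [set p; q; r] \subset [set y | e x y].
  by apply/subsetP => y; rewrite !inE => /orP[/orP[]|] /eqP->.
move/subset_leq_card/leq_trans/(_ (deg2 x)).
by rewrite setUC cardsU1 cards2 !inE negb_or rp rq pq.
Qed.

(* An edge inside a distance level m around v exists, as otherwise distance parity is a 2-colouring; following parents from its ends down to v closes up a cycle of length 2m + 1 covering the graph. *)
Lemma odd_cycle_ecc v : ~ colourable e 2 -> 2 * ecc e v < #|T|.
Proof.
move=> ncol; pose l := gdist e v.
have [a [b [ab lab]]] : exists a b, e a b /\ l a = l b.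
  case: (boolP [exists a, exists b, e a b && (l a == l b)]).
    by case/existsP=> a /existsP[b /andP[ab /eqP lab]]; exists a, b.
  move=> nex; case: ncol; apply: (colourable_image (f := fun x => odd (l x))).
    move=> x y xy; have lxy : l x != l y.
      apply: contraNneq nex => lxy; apply/existsP; exists x; apply/existsP.
      by exists y; rewrite xy lxy eqxx.
    have := gdist_edge e_con v xy; rewrite e_sym in xy.
    have := gdist_edge e_con v xy; rewrite -/(l x) -/(l y).
    by move: lxy; clear; lia.
  by apply: leq_trans (max_card _) _; rewrite card_bool.
set m := l a.
have l0 x : l x = 0 -> x = v by move/(gdist_eq0 e_con).
have parent x : 0 < l x -> exists2 z, e x z & l x = (l z).+1.
  move=> lx; have xv : x != v by apply: contraTneq lx => ->; rewrite /l gdistxx.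
  by have [z zx lz] := gdist_parent e_con xv; exists z; rewrite // e_sym.
have m0 : 0 < m.
  rewrite lt0n; apply/eqP => /[dup] ma; rewrite /m lab => mb.
  by move: ab; rewrite (l0 _ ma) (l0 _ mb) e_irr.
(* [S] consists of the first [j + 1] vertices of the parent chains from [a] and [b], ending in [p]
   and [q]. Only these ends can have neighbours outside [S], and each already has one inside. *)
have arcs j : j < m -> exists (S : {set T}) (p q : T),
  [/\ [/\ p \in S, q \in S, p != q, l p = m - j & l q = m - j],
      #|S| = 2 * j.+1, {in S, forall x, m - j <= l x <= m},
      {in S, forall x, x != p -> x != q -> forall y, e x y -> y \in S}
    & (exists2 y, y \in S & e p y) /\ (exists2 y, y \in S & e q y)].
  have nab : a != b by apply: contraTneq ab => ->; rewrite e_irr.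
  elim: j => [|j IH] hj.
    exists [set a; b], a, b; rewrite subn0 !inE !eqxx orbT /m; split=> //.
    - by rewrite cards2 nab.
    - by move=> x; rewrite !inE => /orP[] /eqP->; rewrite -?lab leqnn.
    - by move=> x; rewrite !inE => /orP[] /eqP-> //; rewrite eqxx.
    - split; first by exists b; rewrite // !inE eqxx orbT.
      by exists a; rewrite ?inE ?eqxx // e_sym.
  have [S [p [q [[pS qS pq lp lq] cS lS clS [[sp spS psp] [sq sqS qsq]]]]]] :=
    IH (ltnW hj).
  have [|p' pp' lp'] := parent p; first by rewrite lp subn_gt0 ltnW.
  have [|q' qq' lq'] := parent q; first by rewrite lq subn_gt0 ltnW.
  have lp'E : l p' = m - j.+1 by rewrite subnS -lp lp'.
  have lq'E : l q' = m - j.+1 by rewrite subnS -lq lq'.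
  have p'S : p' \notin S by apply/negP => /lS; rewrite -lp lp' ltnn.
  have q'S : q' \notin S by apply/negP => /lS; rewrite -lq lq' ltnn.
  (* A common parent would have three neighbours: [p], [q], and its own parent [g], which exists as
     [j + 1 < m]. *)
  have pq' : p' != q'.
    apply/eqP => pq'; have [|g pg lg] := parent p'; first by rewrite lp'E subn_gt0.
    have p'p : e p' p by rewrite e_sym.
    have p'q : e p' q by rewrite pq' e_sym.
    case: (two_neighbours p'p p'q pq pg) => gE; rewrite gE in lg.
      by move: lp'; rewrite lg; clear; lia.
    by move: lq'; rewrite -pq' lg; clear; lia.
  exists (p' |: (q' |: S)), p', q'; split.
  - by rewrite !inE !eqxx orbT; split.
  - by rewrite !cardsU1 !inE negb_or pq' p'S q'S cS [RHS]mulnS.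
  - move=> x; rewrite !inE => /or3P[/eqP->|/eqP->|/lS/andP[lx ->]].
    + by rewrite lp'E leqnn leq_subr.
    + by rewrite lq'E leqnn leq_subr.
    + by rewrite (leq_trans _ lx) ?leq_sub2l.
  - move=> x; rewrite !inE => /or3P[/eqP->|/eqP->|xS]; rewrite ?eqxx // => _ _ y xy.
    rewrite !inE; case: (eqVneq x p) => [xp|xp].
      rewrite xp in xy; case: (two_neighbours pp' psp _ xy) => [||->].
      + by apply: contraNneq p'S => ->.
      + by move=> ->; rewrite eqxx.
      + by rewrite spS !orbT.
    case: (eqVneq x q) => [xq|xq]; last by rewrite (clS x xS xp xq y xy) !orbT.
    rewrite xq in xy; case: (two_neighbours qq' qsq _ xy) => [||->].
    + by apply: contraNneq q'S => ->.
    + by move=> ->; rewrite eqxx orbT.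
    + by rewrite sqS !orbT.
  - split; first by exists p; rewrite ?inE ?pS ?orbT // e_sym.
    by exists q; rewrite ?inE ?qS ?orbT // e_sym.
have [|S [p [q [[pS qS pq lp lq] cS lS clS [[sp spS psp] [sq sqS qsq]]]]]] :=
  arcs m.-1; first by rewrite ltn_predL.
have m1 : m - m.-1 = 1 by rewrite -subn1 subKn.
have lv : l v = 0 by rewrite /l gdistxx.
have vS : v \notin S by apply/negP => /lS; rewrite m1 lv.
have level1 x : l x = 1 -> e x v.
  move=> lx; have [|z xz lz] := parent x; first by rewrite lx.
  by move: lz; rewrite lx => -[/esym/l0 <-].
have pv : e p v by apply: level1; rewrite lp.
have qv : e q v by apply: level1; rewrite lq.
have ST : v |: S = setT.
  apply/eqP/negPn/negP => ST.
  have vA : v \in v |: S by rewrite !inE eqxx.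
  have [x [y [xA yA xy]]] := boundary_edge e_sym e_con vA ST.
  case/negP: yA; move: xA; rewrite !inE => /orP[/eqP xv|xS].
    rewrite xv in xy; rewrite e_sym in pv; rewrite e_sym in qv.
    by case: (two_neighbours pv qv pq xy) => ->; rewrite ?pS ?qS orbT.
  case: (eqVneq x p) => [xp|xp].
    rewrite xp in xy; case: (two_neighbours pv psp _ xy) => [||->].
    + by apply: contraNneq vS => ->.
    + by move=> ->; rewrite eqxx.
    + by rewrite spS !orbT.
  case: (eqVneq x q) => [xq|xq]; last by rewrite (clS x xS xp xq y xy) !orbT.
  rewrite xq in xy; case: (two_neighbours qv qsq _ xy) => [||->].
  + by apply: contraNneq vS => ->.
  + by move=> ->; rewrite eqxx.
  + by rewrite sqS !orbT.
have em : ecc e v <= m.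
  apply/ecc_leP => y; rewrite -/(l y).
  have : y \in v |: S by rewrite ST inE.
  by rewrite !inE => /orP[/eqP->|/lS/andP[]]; rewrite ?lv.
by rewrite -cardsT -ST cardsU1 vS cS prednK // ltnS leq_pmul2l.
Qed.

End OddCycle.

(** * Upper bound for monotone functions of the eccentricity *)

Section UpperBound.
Local Open Scope nat_scope.
Set Implicit Arguments. Unset Strict Implicit.
Variables (T : finType) (e : rel T).
Hypotheses (e_sym : symmetric e) (e_irr : irreflexive e).
Hypothesis e_con : connected_graph e.
Variables (k : nat) (f : nat -> nat).
Hypotheses (k2 : 2 <= k) (kT : k <= #|T| - 1).
Hypothesis f_mono : {homo f : i j / i <= j}.

Let bound :=
  \sum_(u : T) f (ecc e u) <= \sum_(i < #|T|) f (path_ecc (#|T| - k + 1) i).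

(** The numerical condition says that [m + (n - #|A|)], the diameter after extension to all [n]
    vertices, is at most [n - k + 1]. *)
Lemma tree_metric_bound A delta m x0 : tree_metric e A delta m -> x0 \in A ->
  m + k <= #|A|.+1 -> bound.
Proof.
move=> tm x0A mk.
have [delta' tm'] := spanning_tree_metric e_sym e_con tm x0A.
apply: (tree_metric_sum_ecc (tree_metric_weaken _ tm')) => //; last by lia.
by have := subset_leq_card (subsetT A); rewrite cardsT; lia.
Qed.

Lemma clique_bound : clique_number e = k -> bound.
Proof.
rewrite /clique_number.
have [|A clA cA] := @eq_bigmax_cond _ (is_clique e) (fun S : {set T} => #|S|).
  by apply/card_gt0P; exists set0; apply/forall_inP => x; rewrite inE.
have -> : \max_(S : {set T} | is_clique e S) #|S| = #|A| by [].
move=> Ak; have /card_gt0P[x0 x0A] : 0 < #|A| by rewrite Ak ltnW.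
by apply: (tree_metric_bound (clique_tree_metric clA) x0A); rewrite Ak.
Qed.

Lemma chromatic_bound : chromatic_number e = k -> bound.
Proof.
move=> chi.
have ncol : ~ colourable e k.-1.
  by move/chromatic_number_le; rewrite chi => /(_ _); lia.
have [/existsP[v kv]|] := boolP [exists v, k <= #|[set y | e v y]|].
  have [delta tm] := star_tree_metric e_sym e_con v.
  apply: (tree_metric_bound tm (x0 := v)); first by rewrite !inE eqxx.
  by rewrite card_cnbr // ; lia.
move/existsPn => deg.
have {}deg x : #|[set y | e x y]| <= k.-1 by have := deg x; lia.
have [k3|k3] := leqP k 3; last first.
  have reg x : #|[set y | e x y]| = k.-1.
    apply/eqP; rewrite eqn_leq deg leqNgt; apply/negP => h; apply: ncol.
    exact: (small_degree_colourable e_sym e_irr e_con h deg).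
  have [/existsP[v /existsP[x /andP[vx dbl]]]|dbl] := boolP [exists v, exists x,
      e v x && (k.+1 < #|(v |: [set y | e v y]) :|: (x |: [set y | e x y])|)].
    have [delta tm] := double_star_tree_metric e_sym e_con vx.
    by apply: (tree_metric_bound tm (x0 := v)); [rewrite !inE eqxx | lia].
  case: ncol; apply: swap_regular_colourable => //; first by lia.
  move=> v x vx; rewrite leqNgt; apply: contra dbl => dbl.
  by apply/existsP; exists v; apply/existsP; exists x; rewrite vx.
have [k_2|k_3] : k = 2 \/ k = 3 by move: k2 k3; clear; lia.
  have /card_gt1P[a [b [_ _ ab]]] : 1 < #|T| by move: kT; rewrite k_2; clear; lia.
  have aT : [set a] != setT.
    by apply: contraNneq ab => aT; rewrite eq_sym -in_set1 aT inE.
  have [y [x [_ _ yx]]] := boundary_edge e_sym e_con (set11 a) aT.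
  have nyx : y != x by apply: contraTneq yx => ->; rewrite e_irr.
  have cl : is_clique e [set y; x].
    apply/forall_inP => s; rewrite !inE => /orP[]/eqP->; apply/forall_inP => t;
    by rewrite !inE => /orP[]/eqP->; rewrite ?eqxx ?yx ?implybT // e_sym yx implybT.
  apply: (tree_metric_bound (clique_tree_metric cl) (set21 y x)).
  by rewrite cards2 nyx k_2.
have {}ncol : ~ colourable e 2 by rewrite k_3 in ncol.
have {}deg x : #|[set y | e x y]| <= 2 by rewrite k_3 in deg; exact: deg.
(* For [k = 3] the profile has [d = n - 2], and each of its values is at least the ceiling of
   [(n - 2) / 2], which is [(n - 1)./2]; the comparison is termwise. *)
apply: (@leq_trans (\sum_(u : T) f (#|T|.-1)./2)).
  apply: leq_sum => u _; apply: f_mono.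
  by have := odd_cycle_ecc e_sym e_irr e_con deg u ncol; clear; lia.
rewrite sum_nat_const -[X in X * _](card_ord #|T|) -sum_nat_const.
apply: leq_sum => i _; apply: f_mono; rewrite k_3 /path_ecc.
by have := ltn_ord i; move: kT; rewrite k_3; clear; case: ifP; lia.
Qed.

End UpperBound.

Theorem theorem4p3 (n k : nat) (T : finType) (e : rel T) :
  (2 <= k)%N -> (k <= n - 1)%N ->
  simple_graph e -> connected_graph e -> #|T| = n ->
  (chromatic_number e = k \/ clique_number e = k) ->
  [/\ sigma0 e <= f0 n (n - k + 1)%N,
      (sigma1 e)%:R <= f1 n (n - k + 1)%N,
      sigma0 (@B_rel n (n - k + 1)%N) = f0 n (n - k + 1)%N
    & (sigma1 (@B_rel n (n - k + 1)%N))%:R = f1 n (n - k + 1)%N].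
Proof.
move=> k2 kn [e_sym e_irr] e_con cT chi_or_clique.
have d2 : (2 <= n - k + 1)%N by lia.
have dn : (n - k + 1 < n)%N by lia.
have d_pos : (0 < n - k + 1 < n)%N by rewrite dn ltnW.
(* The identity gives the bound on [sigma0], squaring the one on [sigma1]. *)
have upper (f : nat -> nat) : {homo f : i j / (i <= j)%N} ->
    (\sum_(u : T) f (ecc e u) <= \sum_(i < n) f (path_ecc (n - k + 1) i))%N.
  move=> f_mono; rewrite -cT in kn *.
  by case: chi_or_clique => [chi|cl]; [apply: chromatic_bound | apply: clique_bound].
split.
- rewrite -sum_path_ecc_f0 // /sigma0 cT ler_wpM2r ?invr_ge0 ?ler0n // ler_nat.
  exact: (upper id).
- rewrite -sum_path_ecc_f1 // ler_nat /sigma1.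
  by apply: (upper (fun x => x ^ 2)%N) => i j ij; rewrite leq_exp2r.
- rewrite -sum_path_ecc_f0 // /sigma0 card_ord.
  by under eq_bigr do rewrite ecc_B //.
- rewrite -sum_path_ecc_f1 // /sigma1.
  by under eq_bigr do rewrite ecc_B //.
Qed.
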